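(* Let $E\subset\mathbb{R}^d$ be a homogeneous Moran set with $c_*=\inf_k c_k=0$. Suppose that $$\lim_{k\to+\infty}\frac{\log c_k}{\log (c_1\cdots c_k)}=0 .$$ Then, for every $\theta\in(0,1]$, $$\overline{\dim}_\theta E=\limsup_{k\to\infty}\ \min_{k\le m\le l(k,\theta)}\ -\frac{\log (n_1\cdots n_m)}{\log (c_1\cdots c_m)},$$ and, for every $\theta\in[0,1]$, $$\underline{\dim}_\theta E=\liminf_{k\to\infty}\ -\frac{\log (n_1\cdots n_k)}{\log (c_1\cdots c_k)}=\dim_H E .$$
   Context: Intermediate dimensions. $|\cdot|$ denotes the diameter of a set and $\dim_H$ the Hausdorff dimension. For $E\subset\mathbb{R}^d$ and $0\le\theta\le1$ (with $\delta^{1/\theta}$ read as $0$ when $\theta=0$, so that both dimensions equal $\dim_H E$): $\underline{\dim}_\theta E=\inf\{s\ge0:$ for all $\varepsilon>0$ and $\Delta>0$ there exist $0<\delta\le\Delta$ and a cover $\{U_i\}$ of $E$ such that $\delta^{1/\theta}\le|U_i|\le\delta$ for all $i$ and $\sum|U_i|^s\le\varepsilon\}$; $\overline{\dim}_\theta E=\inf\{s\ge0:$ for all $\varepsilon>0$ there exists $\Delta>0$ such that for all $0<\delta\le\Delta$ there is a cover $\{U_i\}$ of $E$ such that $\delta^{1/\theta}\le|U_i|\le\delta$ for all $i$ and $\sum|U_i|^s\le\varepsilon\}$. Homogeneous Moran sets. Let $\{n_k\}_{k\ge1}$ be integers $\ge2$. $\Sigma^k=\{u_1\cdots u_k:1\le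 u_j\le n_j\}$, $\Sigma^0=\{\emptyset\}$, $\Sigma^*=\bigcup_{k\ge0}\Sigma^k$. Let $J\subset\mathbb{R}^d$ be compact with nonempty interior, and let $c_k>0$ satisfy $n_kc_k^d\le1$ for all $k\ge1$. Let $\{J_{\mathbf{u}}:\mathbf{u}\in\Sigma^*\}$ be closed subsets of $J$ such that: (1) for each $\mathbf{u}$ there is a similarity $\Psi_{\mathbf{u}}:\mathbb{R}^d\to\mathbb{R}^d$ with $J_{\mathbf{u}}=\Psi_{\mathbf{u}}(J)$, and $J_\emptyset=J$; (2) for all $k\ge1$ and $\mathbf{u}\in\Sigma^{k-1}$, the sets $J_{\mathbf{u}1},\dots,J_{\mathbf{u}n_k}$ are subsets of $J_{\mathbf{u}}$ with pairwise disjoint interiors and $|J_{\mathbf{u}i}|/|J_{\mathbf{u}}|=c_k$ for $1\le i\le n_k$. Then $E=\bigcap_{k\ge1}\bigcup_{\mathbf{u}\in\Sigma^k}J_{\mathbf{u}}$ is called a homogeneous Moran set. For $k\ge1$ and $\theta\in(0,1]$, $l(k,\theta)=l$ is the unique integer such that $c_1c_2\cdots c_l\le(c_1c_2\cdots c_k)^{1/\theta}<c_1c_2\cdots c_{l-1}$ (the empty product being $1$). *)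

(* Defs.v *)
From HB Require Import structures.
From mathcomp Require Import all_boot all_order all_algebra.
From mathcomp Require Import all_classical all_reals all_analysis.

Set Implicit Arguments.
Unset Strict Implicit.
Unset Printing Implicit Defensive.

Import Order.TTheory GRing.Theory Num.Theory.
Import numFieldNormedType.Exports.

Local Open Scope classical_set_scope.
Local Open Scope ring_scope.

(* R^d is 'rV[R]_d. Its library norm is the sup norm (which induces the usual
   topology); similarities and diameters are Euclidean, hence enorm. *)
Section euclidean.
Context {R : realType} {d : nat}.
Implicit Types (x y : 'rV[R]_d) (U : set 'rV[R]_d).

Definition enorm x : R := Num.sqrt (\sum_(i < d) x ord0 i ^+ 2).

(* \bar R-valued, so that unbounded sets have diameter +oo; diam set0 = 0. *)
Definition diam U : \bar R :=
  maxe 0%E (ereal_sup [set (enorm (x - y))%:E | x in U & y in U]).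

Definition similarity (Psi : 'rV[R]_d -> 'rV[R]_d) : Prop :=
  exists2 r : R, 0 < r & forall x y, enorm (Psi x - Psi y) = r * enorm (x - y).

End euclidean.

Section dimensions.
Context {R : realType} {d : nat}.
Implicit Types (E : set 'rV[R]_d) (s theta delta : R).

(* {U_i}_(i in I), I a set of naturals, is a finite or countable cover of E
   with a <= |U_i| <= b for all i in I. *)
Definition cover_scales (a b : R) E (I : set nat) (U : nat -> set 'rV[R]_d) :=
  E `<=` \bigcup_(i in I) U i /\
  forall i, I i -> (a%:E <= diam (U i) <= b%:E)%E.

(* Convention: |U_i|^0 = 1, including when |U_i| = 0. *)
Definition cover_sum s (I : set nat) (U : nat -> set 'rV[R]_d) : \bar R :=
  (\esum_(i in I) (diam (U i) `^ s))%E.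

(* The case split is needed because 0^-1 = 0 in R. *)
Definition lower_scale theta delta : R :=
  if theta == 0 then 0 else delta `^ theta^-1.

Definition lower_intermediate_dim theta E : \bar R :=
  ereal_inf [set s%:E | s in [set s : R | 0 <= s /\
    forall eps Delta : R, 0 < eps -> 0 < Delta ->
      exists2 delta : R, 0 < delta <= Delta &
      exists I U, cover_scales (lower_scale theta delta) delta E I U /\
                  (cover_sum s I U <= eps%:E)%E]].

Definition upper_intermediate_dim theta E : \bar R :=
  ereal_inf [set s%:E | s in [set s : R | 0 <= s /\
    forall eps : R, 0 < eps ->
      exists2 Delta : R, 0 < Delta &
      forall delta : R, 0 < delta <= Delta ->
      exists I U, cover_scales (lower_scale theta delta) delta E I U /\
                  (cover_sum s I U <= eps%:E)%E]].

Definition hausdorff_premeasure s delta E : \bar R :=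
  ereal_inf [set x | exists I U,
    cover_scales 0 delta E I U /\ x = cover_sum s I U].

Definition hausdorff_measure s E : \bar R :=
  ereal_sup [set hausdorff_premeasure s delta E | delta in [set r : R | 0 < r]].

Definition hausdorff_dim E : \bar R :=
  ereal_inf [set s%:E | s in
    [set s : R | 0 <= s /\ hausdorff_measure s E = 0%E]].

End dimensions.

(* The sequences n_k, c_k start at k = 1: values at index 0 are never used. *)
Section moran.
Context {R : realType} {d : nat}.
Implicit Types (n : nat -> nat) (c : nat -> R).

(* Words over Sigma^k: the letter u_j is nth 0 u j.-1, in {1, ..., n_j};
   the word ui is rcons u i. *)
Definition words n (k : nat) : set (seq nat) :=
  [set u | size u = k /\
    forall j, (j < k)%N -> (1 <= nth 0%N u j <= n j.+1)%N].

Record moran_structure n c (J : set 'rV[R]_d)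
    (Ju : seq nat -> set 'rV[R]_d) : Prop := {
  moran_n_ge2 : forall k, (1 <= k)%N -> (2 <= n k)%N ;
  moran_c_gt0 : forall k, (1 <= k)%N -> 0 < c k ;
  moran_nc_le1 : forall k, (1 <= k)%N -> (n k)%:R * c k ^+ d <= 1 ;
  moran_compact : compact J ;
  moran_interior : interior J !=set0 ;
  moran_closed : forall k u, words n k u -> closed (Ju u) /\ Ju u `<=` J ;
  moran_similar : forall k u, words n k u ->
    exists2 Psi, similarity Psi & Ju u = Psi @` J ;
  moran_root : Ju [::] = J ;
  moran_children : forall k u, (1 <= k)%N -> words n k.-1 u ->
    forall i, (1 <= i <= n k)%N -> Ju (rcons u i) `<=` Ju u ;
  moran_disjoint : forall k u, (1 <= k)%N -> words n k.-1 u ->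
    forall i j, (1 <= i <= n k)%N -> (1 <= j <= n k)%N -> i <> j ->
    interior (Ju (rcons u i)) `&` interior (Ju (rcons u j)) = set0 ;
  moran_ratio : forall k u, (1 <= k)%N -> words n k.-1 u ->
    forall i, (1 <= i <= n k)%N ->
    fine (diam (Ju (rcons u i))) / fine (diam (Ju u)) = c k
}.

Definition homogeneous_moran_set n c (E : set 'rV[R]_d) : Prop :=
  exists J Ju, moran_structure n c J Ju /\
    E = \bigcap_(k in [set k | (1 <= k)%N]) \bigcup_(u in words n k) Ju u.

End moran.

Section exponents.
Context {R : realType}.
Implicit Types (n : nat -> nat) (c : nat -> R) (theta : R).

Definition cprod c (k : nat) : R := \prod_(1 <= j < k.+1) c j.

Definition nprod n (k : nat) : nat := (\prod_(1 <= j < k.+1) n j)%N.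

(* l(k, theta); the default value 0 is only reached if no such l exists. *)
Definition lindex c (k : nat) theta : nat :=
  xget 0%N [set l | (1 <= l)%N /\
    cprod c l <= cprod c k `^ theta^-1 < cprod c l.-1].

Definition moran_exponent n c (m : nat) : R :=
  - (ln (nprod n m)%:R / ln (cprod c m)).

End exponents.

(* Main.v *)
Require Import Defs.
From mathcomp Require Import all_boot all_order all_algebra.
From mathcomp Require Import all_classical all_reals all_analysis.
From mathcomp Require Import ring lra.
Import Order.TTheory GRing.Theory Num.Theory.
Import numFieldNormedType.Exports.
Local Open Scope classical_set_scope.
Local Open Scope ring_scope.

(** Write C_k = c_1 ... c_k, N_k = n_1 ... n_k and
    s_k = - log N_k / log C_k, so that N_k = C_k^(- s_k).

    Upper bounds come from the natural covers. The set E is covered by N_m balls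
    centered in the cylinders of level m, of any common diameter r at least
    2 |J| C_m ([moran_cover]), at the cost N_m r^s. If s_m < s' < s for
    arbitrarily large m, the choice r = 2 |J| C_m makes this cost arbitrarily
    small along a subsequence of scales, which gives the lower dimensions
    ([lower_le_liminf]). For the upper dimension every small delta must be
    served: choose k with C_k comparable to delta, a level m between k and
    l(k, theta) with s_m < s', and take r as large as the lower constraint
    delta^(1/theta) requires ([upper_le_limsup]).

    Lower bounds come from a mass distribution. Similarities of R^d are onto, so
    each cylinder of level m contains a ball of radius proportional to C_m and a
    set of diameter at most C_m meets a bounded number M of cylinders of level m
    ([cylinders_meeting_bounded]). Giving mass 1 / N_m to each of these, a cover
    U_i of E with |U_i| <= C_(m_i) satisfies 1 <= M * sum_i 1 / N_(m_i)
    ([mass_distribution]); compactness of E reduces this to counting cylinders of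
    one deep level. If C_(m+1) < |U| <= C_m and s < t < s_m then
    1 / N_m <= C_m^t <= C_(m+1)^s <= |U|^s ([nprod_le_diam]), so that sum_i |U_i|^s
    stays away from 0. For the upper dimension at scale delta = C_k the levels m
    that occur are exactly those between k and l(k, theta)
    ([limsup_le_upper]); for the Hausdorff dimension they are all large
    ([liminf_le_hausdorff]). Since dim_H is at most every lower intermediate
    dimension ([hausdorff_le_lower]), the three lower quantities coincide.

    The hypothesis log c_k / log C_k -> 0 says that passing from one scale to the
    next costs an arbitrarily small power of C_k: for s < t, eventually
    C_m^t <= C_(m+1)^s ([scale_step]). *)

(** * Euclidean geometry of R^d *)

Section euclidean.
Context {R : realType} {d : nat}.
Implicit Types (x y z : 'rV[R]_d) (U V : set 'rV[R]_d).

Definition dotp x y : R := \sum_(i < d) x ord0 i * y ord0 i.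

Lemma dotpC x y : dotp x y = dotp y x.
Proof. by apply: eq_bigr => i _; rewrite mulrC. Qed.

Lemma dotpDl x y z : dotp (x + y) z = dotp x z + dotp y z.
Proof. by rewrite -big_split/=; apply: eq_bigr => i _; rewrite mxE mulrDl. Qed.

Lemma dotpZl a x y : dotp (a *: x) y = a * dotp x y.
Proof. by rewrite mulr_sumr; apply: eq_bigr => i _; rewrite mxE mulrA. Qed.

Lemma dotpBl x y z : dotp (x - y) z = dotp x z - dotp y z.
Proof. by rewrite dotpDl -scaleN1r dotpZl mulN1r. Qed.

Lemma dotpBr x y z : dotp x (y - z) = dotp x y - dotp x z.
Proof. by rewrite dotpC dotpBl !(dotpC x). Qed.

Lemma dotp_delta x i : dotp x (delta_mx ord0 i) = x ord0 i.
Proof.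
rewrite /dotp (bigD1 i)//= big1 ?addr0 ?mxE ?eqxx ?mulr1// => j ji.
by rewrite mxE eqxx/= (negbTE ji) mulr0.
Qed.

Lemma dotp_ge0 x : 0 <= dotp x x.
Proof. by apply: sumr_ge0 => i _; rewrite -expr2 sqr_ge0. Qed.

Lemma enorm_ge0 x : 0 <= enorm x.
Proof. exact: sqrtr_ge0. Qed.

Lemma enormE x : enorm x = Num.sqrt (dotp x x).
Proof. by rewrite /enorm; congr Num.sqrt; apply: eq_bigr => i _; rewrite expr2. Qed.

Lemma sqr_enorm x : enorm x ^+ 2 = dotp x x.
Proof. by rewrite enormE sqr_sqrtr ?dotp_ge0. Qed.

Lemma enormZ a x : enorm (a *: x) = `|a| * enorm x.
Proof.
by rewrite !enormE dotpZl dotpC dotpZl mulrA -expr2 sqrtrM ?sqr_ge0// sqrtr_sqr.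
Qed.

Lemma enormN x : enorm (- x) = enorm x.
Proof. by rewrite -scaleN1r enormZ normrN1 mul1r. Qed.

Lemma enormC x y : enorm (x - y) = enorm (y - x).
Proof. by rewrite -enormN opprB. Qed.

Lemma enorm0 : enorm (0 : 'rV[R]_d) = 0.
Proof. by rewrite -(scale0r 0) enormZ normr0 mul0r. Qed.

Lemma enorm_delta i : enorm (delta_mx ord0 i : 'rV[R]_d) = 1.
Proof. by rewrite enormE dotp_delta mxE !eqxx sqrtr1. Qed.

Lemma enorm_eq0 x : enorm x = 0 -> x = 0.
Proof.
move=> x0; have /eqP : \sum_(i < d) x ord0 i * x ord0 i = 0.
  by rewrite -[LHS]/(dotp x x) -sqr_enorm x0 expr0n.
rewrite psumr_eq0; last by move=> i _; rewrite -expr2 sqr_ge0.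
move=> /allP h; apply/rowP => i; rewrite mxE.
have /h/= : i \in index_enum 'I_d by rewrite mem_index_enum.
by rewrite mulf_eq0 orbb => /eqP.
Qed.

(** Cauchy-Schwarz: expand the square norm of |y|^2 x - <x, y> y. *)
Lemma dotp_le_enorm x y : dotp x y <= enorm x * enorm y.
Proof.
have [y0|yN0] := eqVneq (enorm y) 0.
  by rewrite y0 mulr0 (enorm_eq0 y y0) dotpC -(scale0r x) dotpZl mul0r.
apply: ler_normlW; rewrite -ler_sqr ?nnegrE ?normr_ge0 ?mulr_ge0 ?enorm_ge0//.
rewrite real_normK ?num_real// exprMn !sqr_enorm.
have y_gt0 : 0 < dotp y y by rewrite -sqr_enorm exprn_gt0// lt_def yN0 enorm_ge0.
have := dotp_ge0 (dotp y y *: x - dotp x y *: y).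
rewrite dotpBl !dotpBr !dotpZl !(dotpC _ (_ *: _)) !dotpZl (dotpC y x).
set a := dotp y y; set b := dotp x y; set e := dotp x x.
have -> : a * (a * e) - a * (b * b) - (b * (a * b) - b * (b * a)) = a * (e * a - b ^+ 2)
  by ring.
by rewrite pmulr_rge0// subr_ge0.
Qed.

Lemma enormD x y : enorm (x + y) <= enorm x + enorm y.
Proof.
rewrite -ler_sqr ?nnegrE ?addr_ge0 ?enorm_ge0//.
rewrite sqrrD !sqr_enorm dotpDl !(dotpC _ (x + y)) !dotpDl (dotpC y x).
have := dotp_le_enorm x y; lra.
Qed.

Lemma enormB_le x y z : enorm (x - z) <= enorm (x - y) + enorm (y - z).
Proof. by apply: le_trans (enormD _ _); rewrite addrA subrK. Qed.

Lemma coord_le_enorm x i : `|x ord0 i| <= enorm x.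
Proof.
rewrite -ler_sqr ?nnegrE ?enorm_ge0// sqr_enorm real_normK ?num_real// /dotp (bigD1 i)//= expr2.
by rewrite lerDl sumr_ge0// => j _; rewrite -expr2 sqr_ge0.
Qed.

Lemma enorm_le_sum x : enorm x <= \sum_(i < d) `|x ord0 i|.
Proof.
rewrite [x in enorm x]row_sum_delta.
elim/big_rec2: _ => [|i s y _ IH]; first by rewrite enorm0.
by rewrite (le_trans (enormD _ _))// enormZ enorm_delta mulr1 lerD2l.
Qed.

Lemma enorm_lt_coord x (h : R) : (0 < d)%N ->
  (forall i, `|x ord0 i| < h) -> enorm x < d%:R * h.
Proof.
move=> d0 xh; apply: (le_lt_trans (enorm_le_sum x)).
have -> : d%:R * h = \sum_(i < d) h by rewrite sumr_const card_ord mulr_natl.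
by apply: ltr_sum => //; apply/hasP; exists (Ordinal d0); rewrite ?mem_index_enum.
Qed.

Lemma coord_le_norm x i : `|x ord0 i| <= `|x|.
Proof.
by rewrite [leRHS]/Num.Def.normr/= mx_normrE; apply: (le_bigmax _ _ (ord0, i)).
Qed.

Lemma norm_le_enorm x : `|x| <= enorm x.
Proof.
rewrite [leLHS]/Num.Def.normr/= mx_normrE; apply: bigmax_le; first exact: enorm_ge0.
by move=> [i j] _ /=; rewrite ord1 coord_le_enorm.
Qed.

(** Open Euclidean balls are open for the sup norm and form a neighbourhood
    basis, so both norms have the same topology. *)
Lemma nbhs_eball x (r : R) : 0 < r -> nbhs x [set y | enorm (y - x) < r].
Proof.
move=> r0; apply/nbhs_ballP; case: (posnP d) => [d0|d0].
  exists 1 => //= y _ /=; apply: le_lt_trans r0.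
  apply: le_trans (enorm_le_sum _) _; rewrite big1// => i.
  by have := ltn_ord i; rewrite [X in (_ < X)%N]d0.
exists (r / d%:R) => /=; first by rewrite divr_gt0// ltr0n.
move=> y xy /=; have -> : r = d%:R * (r / d%:R).
  by rewrite mulrC divfK// pnatr_eq0 -lt0n.
apply: enorm_lt_coord => // i; apply: le_lt_trans (coord_le_norm _ i) _.
by rewrite distrC; move: xy; rewrite -ball_normE.
Qed.

Lemma open_eball x (r : R) : open [set y | enorm (y - x) < r].
Proof.
rewrite openE => y /= yx; have := @nbhs_eball y (r - enorm (y - x)).
rewrite subr_gt0 => /(_ yx); apply: filterS => z /= zy.
by apply: le_lt_trans (enormB_le z y x) _; lra.
Qed.

Lemma interior_eball U x : interior U x ->
  exists2 r : R, 0 < r & [set y | enorm (y - x) < r] `<=` U.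
Proof.
move=> /nbhs_ballP[r r0 rU]; exists r => // y /= yx; apply: rU.
by rewrite -ball_normE /= distrC; apply: le_lt_trans (norm_le_enorm _) yx.
Qed.

(** ** Diameters *)

Lemma diam_ge x y U : U x -> U y -> ((enorm (x - y))%:E <= diam U)%E.
Proof.
move=> Ux Uy; rewrite /diam le_max; apply/orP; right.
by apply: ereal_sup_ubound; exists x => //; exists y.
Qed.

Lemma diam_le U (r : R) : 0 <= r ->
  (forall x y, U x -> U y -> enorm (x - y) <= r) -> (diam U <= r%:E)%E.
Proof.
move=> r0 h; rewrite /diam ge_max lee_fin r0/=; apply: ge_ereal_sup.
by move=> _ [x Ux [y Uy <-]]; rewrite lee_fin h.
Qed.

Lemma diam_ge0 U : (0 <= diam U)%E.
Proof. by rewrite /diam le_max lexx. Qed.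

Lemma diam_fin U (r : R) : (diam U <= r%:E)%E -> diam U \is a fin_num.
Proof. by move=> h; rewrite ge0_fin_numE ?diam_ge0// (le_lt_trans h) ?ltry. Qed.

Lemma diam_closed_ball x (r : R) : (0 < d)%N -> 0 <= r ->
  diam [set y | enorm (y - x) <= r] = (2 * r)%:E.
Proof.
move=> d0 r0; apply/le_anti/andP; split.
  apply: diam_le => [|y z /= yx zx]; first by rewrite mulr_ge0.
  by have := enormB_le y x z; rewrite (enormC x z); lra.
pose e : 'rV[R]_d := delta_mx ord0 (Ordinal d0).
have -> : 2 * r = enorm ((x + r *: e) - (x - r *: e)).
  have -> : (x + r *: e) - (x - r *: e) = (2 * r) *: e.
    by rewrite opprB addrC addrA subrK -scalerDl; congr (_ *: _); ring.
  by rewrite enormZ enorm_delta mulr1 ger0_norm// mulr_ge0.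
by apply: diam_ge => /=; rewrite (addrC x) addrK ?enormN enormZ enorm_delta mulr1 ger0_norm.
Qed.

Lemma compact_diam_fin U : compact U -> diam U \is a fin_num.
Proof.
move=> /compact_bounded[M [_ hM]]; pose B := `|M| + 1.
have hB x : U x -> `|x| <= B.
  by move=> Ux; apply: (hM B) => //; rewrite /B (le_lt_trans (ler_norm M))// ltrDl.
have hc x i : U x -> `|x ord0 i| <= B.
  move=> Ux; apply: le_trans (hB x Ux).
  exact: coord_le_norm.
apply: (@diam_fin _ (\sum_(i < d) 2 * B)); apply: diam_le.
  by apply: sumr_ge0 => i _; rewrite mulr_ge0 ?addr_ge0.
move=> x y Ux Uy; apply: le_trans (enorm_le_sum _) _; apply: ler_sum => i _.
rewrite !mxE; apply: le_trans (ler_normB _ _) _.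
by have := hc x i Ux; have := hc y i Uy; lra.
Qed.

Lemma interior_diam_gt0 U : (0 < d)%N -> interior U !=set0 -> (0 < diam U)%E.
Proof.
move=> d0 [x /interior_eball[r r0 rU]].
pose e : 'rV[R]_d := delta_mx ord0 (Ordinal d0).
apply: lt_le_trans (@diam_ge (x + (r / 2) *: e) x U _ _); last 2 first.
- apply: rU => /=; rewrite (addrC x) addrK enormZ enorm_delta mulr1 ger0_norm; lra.
- by apply: rU => /=; rewrite subrr enorm0.
by rewrite lte_fin (addrC x) addrK enormZ enorm_delta mulr1 normr_gt0 lt0r_neq0// divr_gt0.
Qed.

(** ** Similarities *)

Lemma diam_similar (Psi : 'rV[R]_d -> 'rV[R]_d) (r : R) U : 0 < r ->
  (forall x y, enorm (Psi x - Psi y) = r * enorm (x - y)) ->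
  diam U \is a fin_num -> diam (Psi @` U) = (r * fine (diam U))%:E.
Proof.
move=> r0 Pr Ufin.
have le : (diam (Psi @` U) <= (r * fine (diam U))%:E)%E.
  apply: diam_le => [|_ _ [x Ux <-] [y Uy <-]].
    by rewrite mulr_ge0 ?fine_ge0 ?diam_ge0 ?ltW.
  rewrite Pr ler_pM2l// -lee_fin fineK//; exact: diam_ge.
have Pfin := diam_fin _ _ le; apply/le_anti/andP; split => //.
rewrite -(fineK Pfin) lee_fin mulrC -ler_pdivlMr// -lee_fin fineK//.
apply: diam_le => [|x y Ux Uy].
  by rewrite divr_ge0 ?fine_ge0 ?diam_ge0 ?ltW.
rewrite ler_pdivlMr// mulrC -Pr -lee_fin fineK//.
by apply: diam_ge; [exists x|exists y].
Qed.

(** An isometry fixing the origin preserves the inner product by polarization,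
    hence maps the standard basis to an orthonormal basis; the coordinates of
    the image of x in that basis are those of x. *)
Lemma isometry_surjective (f : 'rV[R]_d -> 'rV[R]_d) :
  (forall x y, enorm (f x - f y) = enorm (x - y)) ->
  forall y, exists x, f x = y.
Proof.
move=> fiso; have [g gE] : exists g, forall x, g x = f x - f 0 by exists (fun x => f x - f 0).
have gn x : enorm (g x) = enorm x by rewrite gE fiso subr0.
have gB x y : enorm (g x - g y) = enorm (x - y).
  by rewrite !gE opprB addrA subrK fiso.
have gdot x y : dotp (g x) (g y) = dotp x y.
  have := sqr_enorm (g x - g y); rewrite gB sqr_enorm !dotpBl !dotpBr.
  rewrite -(sqr_enorm x) -(sqr_enorm y) -(sqr_enorm (g x)) -(sqr_enorm (g y)) !gn.
  rewrite (dotpC y x) (dotpC (g y) (g x)); lra.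
pose Q : 'M[R]_d := \matrix_(i, j) g (delta_mx ord0 i) ord0 j.
have QQ : Q *m Q^T = 1%:M.
  apply/matrixP => i j; rewrite !mxE.
  transitivity (dotp (g (delta_mx ord0 i)) (g (delta_mx ord0 j))).
    by apply: eq_bigr => k _; rewrite !mxE.
  by rewrite gdot dotp_delta mxE eqxx/= eq_sym.
have gQ x : g x *m Q^T = x.
  apply/rowP => j; rewrite mxE -[RHS]dotp_delta -gdot.
  by apply: eq_bigr => k _; rewrite !mxE.
move=> y; exists ((y - f 0) *m Q^T).
suff : g ((y - f 0) *m Q^T) = y - f 0 by rewrite gE => /addIr.
by rewrite -[LHS]mulmx1 -(mulmx1C QQ) mulmxA gQ -mulmxA (mulmx1C QQ) mulmx1.
Qed.

Lemma similarity_surjective (f : 'rV[R]_d -> 'rV[R]_d) (r : R) : 0 < r ->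
  (forall x y, enorm (f x - f y) = r * enorm (x - y)) ->
  forall y, exists x, f x = y.
Proof.
move=> r0 fr y.
have [|x hx] := @isometry_surjective (fun x => r^-1 *: f x) _ (r^-1 *: y).
  move=> x z; rewrite -scalerBr enormZ fr ger0_norm ?invr_ge0 ?ltW//.
  by rewrite mulrA mulVf ?mul1r// gt_eqF.
exists x; apply: (@scalerI _ _ r^-1) => //.
by rewrite invr_eq0 gt_eqF.
Qed.

(** ** Packing *)

(** Separated points in a ball lie in distinct cells of a cubic grid, and
    boundedly many cells meet the ball. *)
Lemma packing (q rho : R) : (0 < d)%N -> 0 < q -> 0 < rho ->
  exists2 M : nat, (0 < M)%N &
  forall (T : eqType) (s : seq T) (p : T -> 'rV[R]_d) (h : R), 0 < h -> uniq s ->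
  {in s &, forall v w, v != w -> rho * h <= enorm (p v - p w)} ->
  {in s &, forall v w, enorm (p v - p w) <= q * h} ->
  (size s <= M)%N.
Proof.
move=> d0 q0 rho0; pose a := d%:R / rho; pose K := (Num.truncn (a * (2 * q))).+1.
have d0R : 0 < d%:R :> R by rewrite ltr0n.
have a0 : 0 < a by rewrite divr_gt0.
exists (K ^ d)%N => [|T s p h h0 us sep bnd]; first by rewrite expn_gt0.
case: s us sep bnd => [//|v0 s'] us sep bnd; set s := v0 :: s' in us sep bnd *.
pose o v i : R := (a / h) * ((p v - p v0) ord0 i + q * h).
have o0 v i : v \in s -> 0 <= o v i < K%:R.
  move=> vs; have := bnd _ _ vs (mem_head _ _ : v0 \in s).
  move=> /(le_trans (coord_le_enorm (p v - p v0) i)); rewrite ler_norml => /andP[h1 h2].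
  rewrite /o mulr_ge0/=; last 2 first.
  - by rewrite divr_ge0// ltW.
  - by rewrite -lerBlDr sub0r.
  apply: (@le_lt_trans _ _ (a * (2 * q))).
    have -> : a * (2 * q) = (a / h) * (q * h + q * h) by field; rewrite gt_eqF.
    by rewrite ler_pM2l ?divr_gt0// lerD2r.
  by rewrite -truncn_le_nat.
pose cell v : {ffun 'I_d -> 'I_K} := [ffun i => inord (Num.truncn (o v i))].
have cell_inj : {in s &, injective cell}.
  move=> v w vs ws /ffunP vw; apply/eqP; apply: contraT => vNw.
  have := sep _ _ vs ws vNw; rewrite leNgt => /negP[].
  have -> : rho * h = d%:R * (h / a).
    by rewrite /a; field; rewrite !gt_eqF.
  apply: enorm_lt_coord => // i.
  have /(congr1 val) := vw i; rewrite !ffunE/= !inordK; last 2 first.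
  - by rewrite truncn_lt_nat; case/andP: (o0 w i ws).
  - by rewrite truncn_lt_nat; case/andP: (o0 v i vs).
  move=> e; have /andP[ov0 _] := o0 v i vs; have /andP[ow0 _] := o0 w i ws.
  have /andP[v1 v2] := truncn_itv ov0; have /andP[w1 w2] := truncn_itv ow0.
  have : `|o v i - o w i| < 1.
    rewrite ltr_norml; rewrite -natr1 in v2; rewrite -natr1 in w2.
    by rewrite e in v1 v2; apply/andP; split; lra.
  have -> : o v i - o w i = (a / h) * (p v - p w) ord0 i.
    by rewrite /o !mxE; ring.
  rewrite normrM (ger0_norm (_ : 0 <= a / h)) ?divr_ge0 ?ltW//.
  by rewrite -ltr_pdivlMl ?divr_gt0// mulr1 invf_div.
have : uniq (map cell s) by rewrite map_inj_in_uniq.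
move=> /card_uniqP; rewrite size_map => <-.
by apply: leq_trans (max_card _) _; rewrite card_ffun !card_ord.
Qed.

End euclidean.

(** * Words *)

Section words.
Variable n : nat -> nat.

Fixpoint wordlist (k : nat) : seq (seq nat) :=
  if k is k'.+1 then [seq rcons u i | u <- wordlist k', i <- iota 1 (n k)]
  else [:: [::]].

Lemma words0 u : words n 0 u <-> u = [::].
Proof. by split=> [[/size0nil]|->//]. Qed.

Lemma words_rcons k u i :
  words n k.+1 (rcons u i) <-> words n k u /\ (1 <= i <= n k.+1)%N.
Proof.
split=> [[/eqP]|[[su ul] il]].
  rewrite size_rcons eqSS => /eqP su ul; split; [split=> // j jk|].
    by have := ul j (ltnW jk); rewrite nth_rcons su jk.
  by have := ul k (ltnSn k); rewrite nth_rcons su ltnn eqxx.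
split=> [|j]; first by rewrite size_rcons su.
rewrite ltnS leq_eqVlt nth_rcons su => /orP[/eqP->|jk]; first by rewrite ltnn eqxx.
by rewrite jk ul.
Qed.

Lemma words_last k u : words n k.+1 u -> exists v i,
  [/\ u = rcons v i, words n k v & (1 <= i <= n k.+1)%N].
Proof.
case/lastP: u => [[]//|v i] /words_rcons[wv il].
by exists v, i.
Qed.

Lemma wordlistP k u : reflect (words n k u) (u \in wordlist k).
Proof.
apply: (iffP idP); elim: k u => [u|k IH u] /=.
- by rewrite inE => /eqP ->; apply/words0.
- case/allpairsP => -[v i] [/= vk]; rewrite mem_iota add1n ltnS => il ->.
  by apply/words_rcons; split=> //; exact: IH.
- by rewrite inE => /words0 ->.
- move=> /words_last[v [i [-> wv il]]]; apply/allpairsP; exists (v, i).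
  by rewrite /= mem_iota add1n ltnS; split=> //; exact: IH.
Qed.

Lemma wordlist_uniq k : uniq (wordlist k).
Proof.
elim: k => [//|k IH]; apply: allpairs_uniq => //; first exact: iota_uniq.
by move=> [u i] [v j] _ _ /= /rcons_inj[-> ->].
Qed.

Lemma nprodS k : nprod n k.+1 = (nprod n k * n k.+1)%N.
Proof. by rewrite /nprod big_nat_recr. Qed.

Lemma nprod0 : nprod n 0 = 1%N.
Proof. by rewrite /nprod big_geq. Qed.

Lemma size_wordlist k : size (wordlist k) = nprod n k.
Proof.
by elim: k => [|k IH]; rewrite ?nprod0// nprodS/= size_allpairs IH size_iota.
Qed.

Lemma words_take m k u : (m <= k)%N -> words n k u -> words n m (take m u).
Proof.
move=> mk [su ul]; split=> [|j jm]; first by rewrite size_take su; case: ltngtP mk.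
by rewrite nth_take//; apply: ul; exact: leq_trans mk.
Qed.

(** All words of length m have the same number N_L / N_m of extensions of length
    L; stated as a product to avoid the division. *)
Lemma count_take (Q : pred (seq nat)) m L : (m <= L)%N ->
  (count (fun u => Q (take m u)) (wordlist L) * nprod n m =
   count Q (wordlist m) * nprod n L)%N.
Proof.
elim: L => [|L IH]; first by rewrite leqn0 => /eqP ->.
rewrite leq_eqVlt => /orP[/eqP->|].
  congr (_ * _)%N; apply: eq_in_count => u /wordlistP[su _].
  by rewrite -su take_size.
rewrite ltnS => mL; rewrite nprodS mulnA -IH// mulnAC; congr (_ * _)%N.
rewrite [wordlist L.+1]/=; have : {in wordlist L, forall u, size u = L}.
  by move=> u /wordlistP[].
elim: (wordlist L) => [//|u s IHs] us /=.
rewrite count_cat mulnDl IHs; last by move=> v vs; rewrite us// inE vs orbT.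
congr (_ + _)%N; rewrite count_map.
rewrite (@eq_count _ _ (fun=> Q (take m u))).
  by case: (Q _); rewrite ?count_predT ?size_iota ?mul1n// count_pred0 mul0n.
by move=> i /=; rewrite -cats1 takel_cat// us ?mem_head.
Qed.

End words.

Section cprod.
Context {R : realType} (c : nat -> R).

Lemma cprodS k : cprod c k.+1 = cprod c k * c k.+1.
Proof. by rewrite /cprod big_nat_recr. Qed.

Lemma cprod0 : cprod c 0 = 1.
Proof. by rewrite /cprod big_geq. Qed.

End cprod.

(** * Upper and lower limits *)

Section limits.
Context {R : realType}.
Implicit Types (u : nat -> \bar R) (x A : \bar R).

Lemma limn_esup_inf u : limn_esup u = ereal_inf (range (esups u)).
Proof. by rewrite limn_esup_lim; apply/cvg_lim => //; exact: cvg_esups_inf. Qed.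

Lemma limn_esup_lt u x : (limn_esup u < x)%E ->
  exists K, forall k, (K <= k)%N -> (u k < x)%E.
Proof.
rewrite limn_esup_inf => /ereal_inf_lt[_ [K _ <-]] Kx; exists K => k Kk.
by apply: le_lt_trans Kx; apply: ereal_sup_ubound; exists k.
Qed.

Lemma limn_esup_gt u x : (x < limn_esup u)%E ->
  forall K, exists2 k, (K <= k)%N & (x < u k)%E.
Proof.
rewrite limn_esup_inf => xu K.
have /ereal_sup_gt[_ [k Kk <-] xk] : (x < esups u K)%E.
  by apply: lt_le_trans xu _; apply: ereal_inf_lbound; exists K.
by exists k.
Qed.

Lemma limn_einf_gt u x : (x < limn_einf u)%E ->
  exists K, forall k, (K <= k)%N -> (x < u k)%E.
Proof.
rewrite /limn_einf lteNr => /limn_esup_lt[K hK]; exists K => k /hK.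
by rewrite lteN2.
Qed.

Lemma limn_einf_lt u x : (limn_einf u < x)%E ->
  forall K, exists2 k, (K <= k)%N & (u k < x)%E.
Proof.
rewrite /limn_einf lteNl => h K; have [k Kk] := limn_esup_gt _ _ h K.
by rewrite lteN2; exists k.
Qed.

Lemma lte_dense_left A (s : R) : (A < s%:E)%E -> exists2 t : R, (A < t%:E)%E & t < s.
Proof.
case: A => [r| |]; rewrite ?lte_fin ?ltNge ?leey// => rs.
- by exists ((r + s) / 2); rewrite ?lte_fin; lra.
- by exists (s - 1); rewrite ?ltNyr//; lra.
Qed.

Lemma lte_dense_right A (s : R) : (s%:E < A)%E -> exists2 t : R, s < t & (t%:E < A)%E.
Proof.
rewrite -lteN2 => /lte_dense_left[t]; rewrite lteNl => tA ts.
by exists (- t) => //; lra.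
Qed.

Lemma lee_by_real A x : (forall s : R, (x < s%:E)%E -> (A <= s%:E)%E) -> (A <= x)%E.
Proof.
case: x => [r| |] h; last 2 first.
- exact: leey.
- case: A h => [r| |] h //; last by have := h 0 (ltNyr _).
  by have := h (r - 1) (ltNyr _); rewrite lee_fin => ?; exfalso; lra.
by apply/lee_addgt0Pr => e e0; apply: h; rewrite lte_fin ltrDl.
Qed.

End limits.

(** * Counting and summation *)

Lemma powR_expR {R : realType} (x y : R) : 0 < x -> x `^ y = expR (y * ln x).
Proof. by move=> x0; rewrite /powR gt_eqF. Qed.

Lemma powR_le_self {R : realType} (x y : R) : 0 < x -> x <= 1 -> 1 <= y ->
  x `^ y <= x.
Proof.
move=> x0 x1 y1; rewrite powR_expR// -[leRHS](@lnK _ x) ?posrE// ler_expR.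
have := ln_le0 x1; nra.
Qed.

Lemma size_le_sum_count (T I : eqType) (s : seq T) (F : seq I) (P : I -> pred T) :
  (forall u, u \in s -> exists2 i, i \in F & P i u) ->
  (size s <= \sum_(i <- F) count (P i) s)%N.
Proof.
elim: s => [//|u s IH] cov /=; rewrite big_split/= -add1n leq_add//; last first.
  by apply: IH => v vs; apply: cov; rewrite inE vs orbT.
have [i iF Piu] := cov u (mem_head _ _).
by rewrite (big_rem i)//= Piu.
Qed.

Lemma sum_half_le2 {R : realFieldType} (F : seq nat) : uniq F ->
  \sum_(i <- F) 2^-1 ^+ i <= 2 :> R.
Proof.
move=> uF; pose B := (\max_(i <- F) i).+1.
have FB i : i \in F -> (i < B)%N by move=> iF; rewrite ltnS; apply: leq_bigmax_seq.
have -> : \sum_(i <- F) 2^-1 ^+ i = \sum_(i <- iota 0 B | i \in F) 2^-1 ^+ i :> R.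
  rewrite -[RHS]big_filter; apply: perm_big; apply: uniq_perm => //.
    by rewrite filter_uniq ?iota_uniq.
  by move=> i; rewrite mem_filter mem_iota /=; case: (boolP (i \in F)) => // /FB ->.
apply: (@le_trans _ _ (\sum_(0 <= i < B) 2^-1 ^+ i)).
  rewrite /index_iota subn0 big_mkcond/=; apply: ler_sum => i _.
  by case: ifP => // _; rewrite exprn_ge0// invr_ge0.
suff -> : \sum_(0 <= i < B) 2^-1 ^+ i = 2 - 2 * 2^-1 ^+ B :> R.
  by rewrite gerBl mulr_ge0// exprn_ge0// invr_ge0.
elim: B {FB} => [|B IH]; first by rewrite big_geq// expr0; ring.
by rewrite big_nat_recr//= IH exprS; field.
Qed.

(** * Homogeneous Moran sets *)

Section moran.
Context {R : realType} {d : nat} (n : nat -> nat) (c : nat -> R).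
Context (J : set 'rV[R]_d) (Ju : seq nat -> set 'rV[R]_d).
Context (hM : moran_structure n c J Ju).

Let C := cprod c.
Let N := nprod n.
Let D := fine (diam J).
Let E := \bigcap_(k in [set k | (1 <= k)%N]) \bigcup_(u in words n k) Ju u.

Let d0 : (0 < d)%N.
Proof.
rewrite lt0n; apply/negP => /eqP d0.
have := moran_nc_le1 hM (isT : (1 <= 1)%N); rewrite d0 expr0 mulr1 lern1.
by have := moran_n_ge2 hM (isT : (1 <= 1)%N); case: (n 1%N) => [|[]].
Qed.

Let C0 k : 0 < C k.
Proof.
elim: k => [|k IH]; first by rewrite /C cprod0.
by rewrite /C cprodS mulr_gt0// (moran_c_gt0 hM).
Qed.

Lemma diamJ_fin : diam J \is a fin_num.
Proof. exact/compact_diam_fin/(moran_compact hM). Qed.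

Let D0 : 0 < D.
Proof.
rewrite -lte_fin fineK ?diamJ_fin//.
exact/interior_diam_gt0/(moran_interior hM)/d0.
Qed.

Lemma diam_cylinder k u : words n k u -> diam (Ju u) = (C k * D)%:E.
Proof.
have fin l v : words n l v -> diam (Ju v) \is a fin_num.
  move=> /(moran_similar hM)[Psi [r r0 Pr] ->].
  by rewrite (diam_similar _ _ _ r0 Pr) ?diamJ_fin.
elim: k u => [u /words0 ->|k IH _ /words_last[u [i [-> wu il]]]].
  by rewrite (moran_root hM) /C cprod0 mul1r fineK ?diamJ_fin.
have wui : words n k.+1 (rcons u i) by apply/words_rcons.
have := @moran_ratio _ _ _ _ _ _ hM k.+1 u isT wu i il.
rewrite (IH _ wu) -(fineK (fin _ _ wui)) /= => e; rewrite /C cprodS -e; congr EFin.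
have := D0; have := C0 k; rewrite /C; move: (fine (diam (Ju _))) => x a0 b0.
by field; rewrite !gt_eqF.
Qed.

Lemma cylinder_dist k u x y : words n k u -> Ju u x -> Ju u y ->
  enorm (x - y) <= C k * D.
Proof.
by move=> wu ux uy; rewrite -lee_fin -(diam_cylinder _ _ wu); exact: diam_ge.
Qed.

Lemma cylinder_take m k u : (m <= k)%N -> words n k u -> Ju u `<=` Ju (take m u).
Proof.
elim: k u => [|k IH] u mk wu.
  by move: mk wu; rewrite leqn0 => /eqP -> /words0 ->.
move: mk; rewrite leq_eqVlt => /orP[/eqP->|mk].
  by case: wu => su _; rewrite -su take_size.
have [v [i [-> wv il]]] := words_last _ _ _ wu.
rewrite -cats1 takel_cat; last by case: wv => ->.
rewrite cats1; apply: subset_trans (IH v mk wv).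
exact: (@moran_children _ _ _ _ _ _ hM k.+1).
Qed.

Lemma cylinders_disjoint k u v : words n k u -> words n k v -> u <> v ->
  interior (Ju u) `&` interior (Ju v) = set0.
Proof.
elim: k u v => [u v /words0-> /words0->//|k IH u0 v0].
move=> /words_last[u [i [-> wu il]]] /words_last[v [j [-> wv jl]]] uv.
have [e|/eqP uNv] := eqVneq u v.
  rewrite -e; apply: (@moran_disjoint _ _ _ _ _ _ hM k.+1) => // ij.
  by apply: uv; rewrite e ij.
rewrite -subset0 -(IH _ _ wu wv uNv); apply: setISS; apply: interiorS.
- exact: (@moran_children _ _ _ _ _ _ hM k.+1).
- exact: (@moran_children _ _ _ _ _ _ hM k.+1).
Qed.

(** The image of a fixed ball of J under the similarity of J_u: similarities
    are onto, so the image is a full ball of radius proportional to C_k. *)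
Lemma cylinder_ball : exists2 rho : R, 0 < rho & forall k u, words n k u ->
  exists p, [set y | enorm (y - p) < rho * C k] `<=` Ju u.
Proof.
have [x0 /interior_eball[rho rho0 sub]] := moran_interior hM.
exists rho => // k u wu; have := diam_cylinder _ _ wu.
have [Psi [r r0 Pr] JE] := moran_similar hM wu.
rewrite JE (diam_similar _ _ _ r0 Pr) ?diamJ_fin// => -[rC].
have {}rC : r = C k by apply: mulIf rC; rewrite gt_eqF// D0.
exists (Psi x0) => y /=; have [x <-] := similarity_surjective _ _ r0 Pr y.
rewrite Pr mulrC -rC ltr_pM2r// => xx0; exists x => //; exact: sub.
Qed.

(** ** Mass distribution *)

Lemma moran_subset k : E `<=` \bigcup_(u in words n k) Ju u.
Proof.
case: k => [|k] x Ex; last exact: Ex.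
have [u wu /(moran_closed hM wu).2 Jx] := Ex 1%N isT.
by exists [::]; [exact/words0|rewrite (moran_root hM)].
Qed.

Let N0 k : (0 < N k)%N.
Proof.
elim: k => [|k IH]; first by rewrite /N nprod0.
by rewrite /N nprodS muln_gt0 IH ltnW// (moran_n_ge2 hM).
Qed.

Lemma nprod_ge k : (2 ^ k <= N k)%N.
Proof.
elim: k => [|k IH]; first by rewrite /N nprod0.
by rewrite /N nprodS expnSr leq_mul// (moran_n_ge2 hM).
Qed.

Lemma moran_set_compact : compact E.
Proof.
apply: subclosed_compact (moran_compact hM) _.
  apply: closed_bigI => k _; apply: closed_bigcup => [|u wu]; last first.
    exact: (moran_closed hM wu).1.
  suff -> : words n k = [set` wordlist n k] by exact: finite_seq.
  by apply/seteqP; split=> u /= /wordlistP.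
by move=> x /(moran_subset 0)[u /words0 ->]; rewrite (moran_root hM).
Qed.

Lemma cylinder_nonempty k u : words n k u -> Ju u !=set0.
Proof.
move=> wu; have [Psi _ ->] := moran_similar hM wu.
by have [x /interior_subset Jx] := moran_interior hM; exists (Psi x), x.
Qed.

(** Extend u by the letter 1 forever: the nested compact cylinders so obtained
    have a common point. *)
Lemma cylinder_meets_moran k u : words n k u -> (Ju u `&` E) !=set0.
Proof.
move=> wu; pose v j := u ++ nseq j 1%N.
have wv j : words n (k + j) (v j).
  elim: j => [|j IH]; first by rewrite addn0 /v cats0.
  rewrite /v -addn1 nseqD catA cats1 addnA addn1; apply/words_rcons.
  by split=> //; rewrite leqnn ltnW// (moran_n_ge2 hM).
have sv i j : (i <= j)%N -> Ju (v j) `<=` Ju (v i).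
  move=> ij; have <- : take (k + i) (v j) = v i.
    by case: wu => <- _; rewrite /v takeD take_size_cat// drop_size_cat// take_nseq.
  by apply: (cylinder_take _ _ _ _ (wv j)); rewrite leq_add2l.
have /choice[x vx] j : exists x, Ju (v j) x.
  by have [x] := cylinder_nonempty _ _ (wv j); exists x.
have [|p [_ pc]] := @moran_compact _ _ _ _ _ _ hM (x @ \oo) _.
  exists 0%N => // j _ /=.
  by apply: (moran_closed hM (wv j)).2; exact: vx.
have vp j : Ju (v j) p.
  have := (moran_closed hM (wv j)).1; apply => B pB.
  by apply: pc => //; exists j => // i /= ji; apply: sv ji _ (vx i).
exists p; split; first by have := vp 0%N; rewrite /v cats0.
move=> i _; have wi := wv i; exists (take i (v i)).
  by apply: words_take wi; exact: leq_addl.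
by apply: (cylinder_take _ _ _ _ wi) => //; exact: leq_addl.
Qed.

(** The balls contained in distinct cylinders of level k are disjoint, so their
    centers are separated at scale C_k. *)
Lemma cylinders_meeting_bounded : exists2 M : nat, (0 < M)%N &
  forall k (U : set 'rV[R]_d), (forall x y, U x -> U y -> enorm (x - y) <= 2 * C k) ->
  (count (fun u => `[< (Ju u `&` U) !=set0 >]) (wordlist n k) <= M)%N.
Proof.
have [rho rho0 hb] := cylinder_ball.
have /choice[p hp] u : exists p, words n (size u) u ->
    [set y | enorm (y - p) < rho * C (size u)] `<=` Ju u.
  have [wu|nwu] := pselect (words n (size u) u); last by exists 0.
  by have [p hp] := hb _ _ wu; exists p.
have q0 : 0 < 2 * D + 2 by have := D0; lra.
have [M M0 pack] := packing _ _ d0 q0 rho0.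
exists M => // k U dU; rewrite -size_filter.
have {}hp u : words n k u -> [set y | enorm (y - p u) < rho * C k] `<=` Ju u.
  by move=> wu; move: (wu) (hp u); case: (wu) => -> _ {}wu /(_ wu).
have pu u : words n k u -> Ju u (p u).
  by move=> wu; apply: (hp u) => //=; rewrite subrr enorm0 mulr_gt0.
apply: (pack _ _ p (C k)) => //; first by rewrite filter_uniq ?wordlist_uniq.
  move=> u v; rewrite !mem_filter => /andP[_ /wordlistP wu] /andP[_ /wordlistP wv] /eqP uv.
  rewrite leNgt; apply/negP => puv.
  suff : (interior (Ju u) `&` interior (Ju v)) (p v).
    by rewrite (cylinders_disjoint _ _ _ wu wv uv).
  split; last by apply: filterS (hp v wv) _; apply: nbhs_eball; exact: mulr_gt0.
  apply: filterS (hp u wu) _; apply: open_nbhs_nbhs; split=> /=.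
    exact: open_eball.
  by rewrite enormC.
move=> u v; rewrite !mem_filter.
move=> /andP[/asboolP[x [ux Ux]] /wordlistP wu] /andP[/asboolP[y [vy Uy]] /wordlistP wv].
have := cylinder_dist _ _ _ _ wu (pu u wu) ux.
have := cylinder_dist _ _ _ _ wv vy (pu v wv).
have := enormB_le (p u) x (p v); have := enormB_le x y (p v); have := dU _ _ Ux Uy.
rewrite -/D -/C; lra.
Qed.

(** A cover of E is refined, by compactness, to a finite cover by slightly larger
    open sets. Deep enough cylinders of level L are then counted: each one meets
    a member V_i of the cover, so extends one of the boundedly many cylinders of
    level m_i meeting V_i, each of which has N_L / N_(m_i) extensions. *)
Lemma mass_distribution : exists2 M : nat, (0 < M)%N &
  forall (I : set nat) (U : nat -> set 'rV[R]_d) (m : nat -> nat),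
  E `<=` \bigcup_(i in I) U i ->
  (forall i, I i -> (diam (U i) <= (C (m i))%:E)%E) ->
  exists F : seq nat, [/\ uniq F, (forall i, i \in F -> I i) &
    1 <= M%:R * \sum_(i <- F) (N (m i))%:R^-1 :> R].
Proof.
have [M M0 hcount] := cylinders_meeting_bounded; exists M => // I U m EU dU.
pose V i := \bigcup_(x in U i) [set y | enorm (y - x) < C (m i) / 2].
have Cm0 i : 0 < C (m i) := C0 (m i).
have UV i : U i `<=` V i.
  by move=> x Ux; exists x => //=; rewrite subrr enorm0 divr_gt0.
have oV i : I i -> open (V i) by move=> _; apply: bigcup_open => x _; exact: open_eball.
have EV : E `<=` \bigcup_(i in I) V i by apply: subset_trans EU _; exact: subset_bigcup.
have dV i : I i -> forall x y, V i x -> V i y -> enorm (x - y) <= 2 * C (m i).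
  move=> Ii x y [x' Ux' /= xx'] [y' Uy' /= yy'].
  have /le_trans/(_ (dU i Ii)) := diam_ge _ _ _ Ux' Uy'; rewrite lee_fin.
  have := enormB_le x x' y; have := enormB_le x' y' y; rewrite (enormC y' y); lra.
have := moran_set_compact; rewrite compact_cover => /(_ _ _ _ oV EV)[F0 FI EF].
pose F : seq nat := finmap.enum_fset F0.
have FI' i : i \in F -> I i by move=> /FI; rewrite inE.
exists F; split => //; first exact: finmap.fset_uniq.
pose L := (\max_(i <- F) m i)%N.
have mL i : i \in F -> (m i <= L)%N by move=> iF; apply: leq_bigmax_seq.
pose Q i : pred (seq nat) := fun u => `[< (Ju u `&` V i) !=set0 >].
have cov u : u \in wordlist n L -> exists2 i, i \in F & Q i (take (m i) u).
  move=> /wordlistP wu; have [x [ux Ex]] := cylinder_meets_moran _ _ wu.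
  have [i /= iF Vx] := EF x Ex; exists i => //.
  by apply/asboolP; exists x; split=> //; exact: (cylinder_take _ _ _ (mL i iF) wu).
have := size_le_sum_count _ _ _ _ (fun i u => Q i (take (m i) u)) cov.
rewrite size_wordlist -(ler_nat R) natr_sum => le.
have NL0 : 0 < (N L)%:R :> R by rewrite ltr0n N0.
rewrite -(ler_pM2l NL0) mulr1; apply: le_trans le _.
rewrite mulrCA !mulr_sumr !big_seq; apply: ler_sum => i iF.
have Nm0 : 0 < (N (m i))%:R :> R by rewrite ltr0n N0.
rewrite !mulrA ler_pdivlMr// -!natrM ler_nat.
rewrite [X in (X <= _)%N]/= [X in (X <= _)%N](count_take n (Q i) _ _ (mL i iF)).
by rewrite leq_pmul2r ?N0// hcount// => x y; exact: dV (FI' i iF) _ _.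
Qed.

(** ** Coverings by balls centered in the cylinders of a given level *)

(** Balls, rather than the cylinders themselves, because intermediate dimensions
    constrain diameters from below: the diameter of a ball can be prescribed. *)
Lemma moran_cover k (r : R) : 2 * D * C k <= r -> exists (I : set nat) U,
  cover_scales r r E I U /\ forall s, cover_sum s I U = ((N k)%:R * r `^ s)%:E.
Proof.
move=> Cr; have r0 : 0 <= r by apply: le_trans Cr; rewrite !mulr_ge0 ?ltW.
have /choice[p hp] u : exists p, words n k u -> Ju u p.
  have [wu|nwu] := pselect (words n k u); last by exists 0.
  by have [p hp] := cylinder_nonempty _ _ wu; exists p.
pose U i := [set y | enorm (y - p (nth [::] (wordlist n k) i)) <= r / 2].
have dU i : diam (U i) = r%:E.
  by rewrite /U diam_closed_ball ?divr_ge0//; congr EFin; field.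
exists [set i | (i < N k)%N], U; split; first split.
- move=> x /(moran_subset k)[u wu ux].
  have uk : u \in wordlist n k by apply/wordlistP.
  exists (index u (wordlist n k)) => /=.
    by rewrite /N -size_wordlist index_mem.
  rewrite /U /= nth_index//.
  have := cylinder_dist _ _ _ _ wu ux (hp u wu); rewrite -/D -/C; lra.
- by move=> i _; rewrite dU lexx.
- move=> s; rewrite /cover_sum esum_fset//; last by move=> i _; exact: poweR_ge0.
  rewrite -fsbig_ord; under eq_bigr do rewrite dU poweR_EFin.
  by rewrite sumEFin sumr_const card_ord mulr_natl.
Qed.

(** ** Asymptotics of the products *)

Lemma ratio_lt1 k : (1 <= k)%N -> c k < 1.
Proof.
move=> k1; rewrite ltNge; apply/negP => ck.
have := moran_nc_le1 hM k1; apply/negP; rewrite -ltNge.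
have nk : 2 <= (n k)%:R :> R by rewrite (ler_nat _ 2) (moran_n_ge2 hM).
have := exprn_ege1 d ck; nra.
Qed.

Lemma cprod_ltS k : C k.+1 < C k.
Proof. by rewrite /C cprodS gtr_pMr ?ratio_lt1// C0. Qed.

Lemma cprod_le i j : (i <= j)%N -> C j <= C i.
Proof.
elim: j => [|j IH]; first by rewrite leqn0 => /eqP ->.
rewrite leq_eqVlt => /orP[/eqP->//|]; rewrite ltnS => /IH; apply: le_trans.
exact/ltW/cprod_ltS.
Qed.

Lemma cprod_lt i j : (i < j)%N -> C j < C i.
Proof. by move=> /cprod_le/le_lt_trans; apply; exact: cprod_ltS. Qed.

Lemma cprod_lt1 k : (1 <= k)%N -> C k < 1.
Proof. by move=> /cprod_lt; rewrite /C cprod0. Qed.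

Lemma nprod_cprod_le1 k : (N k)%:R * C k ^+ d <= 1.
Proof.
elim: k => [|k IH]; first by rewrite /N /C nprod0 cprod0 expr1n mulr1.
rewrite /N /C nprodS cprodS natrM exprMn mulrACA.
by rewrite mulr_ile1 ?mulr_ge0 ?exprn_ge0 ?ler0n ?(moran_nc_le1 hM)// ltW ?C0//
  (moran_c_gt0 hM).
Qed.

(** C_k tends to 0 at a rate forced by volume: C_k^d <= 1 / N_k <= 2^(-k). *)
Lemma cprod_small (e : R) : 0 < e -> exists K, forall k, (K <= k)%N -> C k < e.
Proof.
move=> e0; have ed0 : 0 < e ^+ d by exact: exprn_gt0.
exists (Num.truncn (e ^+ d)^-1).+1 => k Kk; apply: le_lt_trans (cprod_le _ _ Kk) _.
set K := _.+1; rewrite -(ltr_pXn2r d0) ?nnegrE ?ltW//.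
have K2 : (e ^+ d)^-1 < (N K)%:R.
  apply: (@lt_le_trans _ _ K%:R); first by rewrite truncnS_gt.
  by rewrite ler_nat (leq_trans _ (nprod_ge K))// ltnW// ltn_expl.
have := nprod_cprod_le1 K; rewrite mulrC -ler_pdivlMr ?ltr0n// mul1r.
by move=> /le_lt_trans; apply; rewrite invf_plt ?posrE ?ltr0n.
Qed.

Lemma cprod_powR_small (a b e : R) : 0 < b -> 0 < e ->
  exists K, forall k, (K <= k)%N -> a * C k `^ b <= e.
Proof.
move=> b0 e0; have a0 : 0 < `|a| + 1 by rewrite ltr_wpDl.
have q0 : 0 < e / (`|a| + 1) by exact: divr_gt0.
have [K hK] := cprod_small _ (powR_gt0 b^-1 q0); exists K => k /hK Ck.
apply: (@le_trans _ _ ((`|a| + 1) * C k `^ b)).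
  by rewrite ler_wpM2r ?powR_ge0// (le_trans (ler_norm a))// lerDl.
rewrite mulrC -ler_pdivlMr//; apply: le_trans (ge0_ler_powR _ _ _ (ltW Ck)) _.
- exact: ltW.
- by rewrite nnegrE ltW.
- by rewrite nnegrE powR_ge0.
by rewrite -powRrM mulVf ?gt_eqF// powRr1// ltW.
Qed.

(** Cylinders of level m, whose diameter is comparable to C_m, are those suited to
    a set of diameter x. *)
Lemma scale_level K (x : R) : 0 < x -> x <= C K ->
  exists2 m, (K <= m)%N & C m.+1 < x <= C m.
Proof.
move=> x0 xK; have [k0 hk0] := cprod_small _ x0.
pose P m := (K <= m)%N && (C m.+1 < x).
have exP : exists m, P m.
  exists (maxn K k0); rewrite /P leq_maxl hk0//.
  by rewrite (leq_trans (leq_maxr K k0)).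
case: (ex_minnP exP) => m /andP[Km Cm] mmin; exists m; rewrite ?Cm//=.
move: Km; rewrite leq_eqVlt => /orP[/eqP<-//|Km].
case: m => [//|m] in Cm mmin Km *; rewrite leNgt; apply/negP => Cmx.
by have := mmin m; rewrite /P Cmx -ltnS Km ltnn => /(_ isT).
Qed.

(** Since l(k, theta) is positive its predecessor, the other index in its
    definition, is the one made explicit. *)
Lemma lindexP k (theta : R) : (1 <= k)%N -> 0 < theta <= 1 ->
  exists l, [/\ lindex c k theta = l.+1, (k <= l.+1)%N &
    C l.+1 <= C k `^ theta^-1 < C l].
Proof.
move=> k1 /andP[t0 t1]; have v1 : 1 <= theta^-1 by rewrite invf_ge1.
have x0 : 0 < C k `^ theta^-1 by exact: powR_gt0.
have xlt : C k `^ theta^-1 <= C k by rewrite powR_le_self// ltW// cprod_lt1.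
have exl : exists l, (1 <= l)%N /\ C l <= C k `^ theta^-1 < C l.-1.
  have [K hK] := cprod_small _ x0.
  have exP : exists l, C l <= C k `^ theta^-1 by exists K; rewrite ltW ?hK.
  case: (ex_minnP exP) => -[|l] Cl lmin.
    have := le_trans Cl xlt; rewrite leNgt cprod_lt//.
  exists l.+1; split=> //=; rewrite Cl ltNge/=; apply/negP => /lmin.
  by rewrite ltnn.
have := xgetPex 0%N exl; rewrite -[xget _ _]/(lindex c k theta).
case: (lindex c k theta) => [[]//|l] [_ /= /andP[h1 h2]]; exists l; split => //.
  rewrite leqNgt; apply/negP => lk.
  by have := cprod_lt _ _ lk; rewrite ltNge (le_trans h1).
by rewrite h1 h2.
Qed.

Lemma ln_nprod_ge0 k : 0 <= ln (N k)%:R :> R.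
Proof. by rewrite ln_ge0// (ler_nat _ 1). Qed.

Lemma moran_exponent_ge0 k : 0 <= moran_exponent n c k.
Proof.
case: k => [|k]; first by rewrite /moran_exponent nprod0 ln1 mul0r oppr0.
rewrite /moran_exponent -mulrN -invrN divr_ge0 ?ln_nprod_ge0// oppr_ge0 ltW//.
by rewrite ln_lt0// C0 cprod_lt1.
Qed.

Lemma exponent_gt k (t : R) : (1 <= k)%N -> t < moran_exponent n c k ->
  (N k)%:R^-1 <= C k `^ t.
Proof.
move=> k1; have lnC : ln (C k) < 0 by rewrite ln_lt0// C0 cprod_lt1.
rewrite /moran_exponent -mulrN -invrN ltr_pdivlMr ?oppr_gt0// => h.
have Nk0 : 0 < (N k)%:R :> R by rewrite ltr0n.
rewrite -[leLHS]lnK ?posrE ?invr_gt0// powR_expR// ler_expR lnV ?posrE//.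
move: h; rewrite -/C -/N; lra.
Qed.

Lemma exponent_lt k (t : R) : (1 <= k)%N -> moran_exponent n c k < t ->
  (N k)%:R <= C k `^ (- t).
Proof.
move=> k1; have lnC : ln (C k) < 0 by rewrite ln_lt0// C0 cprod_lt1.
rewrite /moran_exponent -mulrN -invrN ltr_pdivrMr ?oppr_gt0// => h.
have Nk0 : 0 < (N k)%:R :> R by rewrite ltr0n.
rewrite -[leLHS]lnK ?posrE// powR_expR// ler_expR.
move: h; rewrite -/C -/N; lra.
Qed.

(** ** Bounds on the dimensions *)

(** If every |U_i|^s dominates the mass 1 / N_m of the cylinders at the scale of
    U_i, the sum of the |U_i|^s is bounded below. The additive slack, which is
    summable over i, accommodates the sets of diameter zero. *)
Lemma no_small_cover : exists (j : nat) (eps : R), 0 < eps /\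
  forall (I : set nat) U s, E `<=` \bigcup_(i in I) U i ->
  (forall i, I i -> exists m, (diam (U i) <= (C m)%:E)%E /\
    (((N m)%:R^-1)%:E <= diam (U i) `^ s + (2^-1 ^+ (i + j))%:E)%E) ->
  ~ (cover_sum s I U <= eps%:E)%E.
Proof.
have [M M0 mass] := mass_distribution.
have MR : 0 < M%:R :> R by rewrite ltr0n.
(* The total mass is at least 1 / M; the sum and the slack contribute at most
   1 / (4 M) and 2 / 2^(4 M) <= 1 / (2 M). *)
exists (4 * M)%N, (4 * M%:R)^-1; split; first by rewrite invr_gt0 mulr_gt0.
move=> I U s EU exm sumU.
have /choice[m hm] i : exists m, I i -> (diam (U i) <= (C m)%:E)%E /\
    (((N m)%:R^-1)%:E <= diam (U i) `^ s + (2^-1 ^+ (i + 4 * M))%:E)%E.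
  have [Ii|nI] := pselect (I i); last by exists 0%N.
  by have [m hm] := exm i Ii; exists m.
have [F [uF FI massF]] := mass I U m EU (fun i Ii => (hm i Ii).1).
have pow0 i : (0 <= diam (U i) `^ s)%E by exact: poweR_ge0.
have sumF : (\sum_(i <- F) diam (U i) `^ s <= ((4 * M%:R)^-1)%:E)%E.
  apply: le_trans sumU; apply: esum_ge; exists [set` F].
    by split; [exact: finite_seq|move=> i /= /FI].
  by rewrite -fsbig_seq.
have tail : \sum_(i <- F) 2^-1 ^+ (i + 4 * M) <= (2 * M%:R)^-1 :> R.
  under eq_bigr do rewrite exprD.
  rewrite -mulr_suml.
  have p0 : 0 <= 2^-1 ^+ (4 * M) :> R by rewrite exprn_ge0// invr_ge0.
  apply: (@le_trans _ _ (2 * 2^-1 ^+ (4 * M))).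
    by rewrite ler_wpM2r// sum_half_le2.
  have -> : (2 * M%:R)^-1 = 2 * (4 * M%:R)^-1 :> R by field; rewrite gt_eqF.
  rewrite ler_pM2l// exprVn lef_pV2 ?posrE ?exprn_gt0 ?mulr_gt0//.
  by rewrite -natrX -natrM ler_nat ltnW// ltn_expl.
have : ((M%:R^-1)%:E <= ((4 * M%:R)^-1)%:E + ((2 * M%:R)^-1)%:E :> \bar R)%E.
  apply: (@le_trans _ _ (\sum_(i <- F) ((N (m i))%:R^-1)%:E)%E).
    by rewrite sumEFin lee_fin -[leLHS]mulr1 ler_pdivrMl.
  apply: (@le_trans _ _ (\sum_(i <- F) (diam (U i) `^ s + (2^-1 ^+ (i + 4 * M))%:E))%E).
    by rewrite big_seq [leRHS]big_seq; apply: lee_sum => i /FI /hm[].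
  by rewrite big_split/=; apply: leeD => //; rewrite sumEFin lee_fin.
rewrite -EFinD lee_fin; have -> : (4 * M%:R)^-1 + (2 * M%:R)^-1 = 3 / 4 * M%:R^-1 :> R.
  by field; rewrite gt_eqF.
by apply/negP; rewrite -ltNge gtr_pMl ?invr_gt0//; lra.
Qed.

(** Balls of one common diameter delta = 2 |J| C_k satisfy the constraint for
    every theta, since delta^(1/theta) <= delta when delta <= 1. *)
Lemma lower_le_liminf (theta : R) : 0 <= theta <= 1 ->
  (lower_intermediate_dim theta E <= limn_einf (fun k => (moran_exponent n c k)%:E))%E.
Proof.
move=> /andP[t0 t1]; apply: lee_by_real => s /lte_dense_left[s' infs' s's].
have freq := limn_einf_lt _ _ infs'.
have s0 : 0 <= s.
  have [k _] := freq 0%N; rewrite lte_fin.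
  by have := moran_exponent_ge0 k; lra.
apply: ereal_inf_lbound; exists s => //; split => // eps Delta eps0 Delta0.
have ss' : 0 < s - s' by rewrite subr_gt0.
have [K1 hK1] := cprod_powR_small ((2 * D) `^ s) _ _ ss' eps0.
have m0 : 0 < Num.min Delta 1 / (2 * D).
  by apply: divr_gt0; [rewrite lt_min Delta0 ltr01|rewrite mulr_gt0].
have [K2 hK2] := cprod_small _ m0.
have [k] := freq (maxn 1 (maxn K1 K2)); rewrite !geq_max => /and3P[k1 kK1 kK2].
rewrite lte_fin => ks'; have := hK2 k kK2.
rewrite ltr_pdivlMr ?mulr_gt0// mulrC lt_min -/C => /andP[dD d1].
have del0 : 0 < 2 * D * C k by rewrite !mulr_gt0.
exists (2 * D * C k); first by rewrite del0 ltW.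
have [I [U [[EU dU] sumU]]] := moran_cover k _ (lexx (2 * D * C k)).
exists I, U; split.
  split=> // i /dU /andP[dl dr]; rewrite dr andbT; apply: le_trans dl.
  rewrite lee_fin /lower_scale; case: eqP => [_|/eqP tN0]; first exact: ltW.
  by apply: powR_le_self => //; [exact: ltW|rewrite invf_ge1// lt_def tN0].
have [D2 Ck] : 0 <= 2 * D /\ 0 <= C k by rewrite mulr_ge0 ltW.
rewrite sumU lee_fin powRM//.
apply: le_trans _ (hK1 k kK1); rewrite mulrCA ler_wpM2l ?powR_ge0//.
apply: (@le_trans _ _ (C k `^ (- s') * C k `^ s)).
  by rewrite ler_wpM2r ?powR_ge0//; exact: exponent_lt _ _ k1 ks'.
by rewrite -powRD ?(gt_eqF (C0 k)) ?implybT// addrC.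
Qed.

(** Dropping the lower constraint on the diameters only enlarges the family of
    admissible covers. *)
Lemma hausdorff_le_lower (theta : R) :
  (hausdorff_dim E <= lower_intermediate_dim theta E)%E.
Proof.
apply: le_ereal_inf_tmp => _ [s [s0 hs] <-].
apply: ereal_inf_lbound; exists s => //; split => //; apply/le_anti/andP; split.
  apply: ge_ereal_sup => _ [delta /= delta0 <-].
  apply/lee_addgt0Pr => eps eps0; rewrite add0e.
  have [r /andP[r0 rdelta] [I [U [[EU dU] sumU]]]] := hs _ _ eps0 delta0.
  apply: le_trans sumU; apply: ereal_inf_lbound; exists I, U; split=> //; split=> //.
  move=> i /dU /andP[_ dr]; rewrite diam_ge0/=; apply: le_trans dr _.
  by rewrite lee_fin.
apply: (@le_trans _ _ (hausdorff_premeasure s 1 E)); last first.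
  by apply: ereal_sup_ubound; exists (1 : R) => //=; exact: ltr01.
apply: le_ereal_inf_tmp => _ [I [U [_ ->]]].
by apply: esum_ge0 => i _; exact: poweR_ge0.
Qed.

Section subexponential.
Context (hlim : (fun k => ln (c k) / ln (cprod c k)) @ \oo --> (0 : R)).

(** This is where the hypothesis on log c_k enters: consecutive scales C_m and
    C_(m+1) are comparable up to an arbitrarily small loss in the exponent. *)
Lemma scale_step (s t : R) : 0 <= s -> s < t ->
  exists K, forall m, (K <= m)%N -> C m `^ t <= C m.+1 `^ s.
Proof.
move=> s0 st; have t0 : 0 < t by lra.
have eta0 : 0 < 1 - s / t by rewrite subr_gt0 ltr_pdivrMr// mul1r.
have /cvgrPdist_lt/(_ _ eta0)[K _ hK] := hlim; exists K => m Km.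
have := hK m.+1 (leqW Km); rewrite /= sub0r normrN => /(le_lt_trans (ler_norm _)).
have lnC : ln (C m.+1) < 0 by rewrite ln_lt0// C0 cprod_lt1.
rewrite ltr_ndivrMr// => h; rewrite !powR_expR// ler_expR.
have : ln (C m.+1) = ln (C m) + ln (c m.+1).
  by rewrite /C cprodS lnM ?posrE ?C0 ?(moran_c_gt0 hM).
move: h; rewrite -/C mulrBl mul1r; set a := ln (C m.+1) => h e.
have : ln (C m) <= s / t * a by lra.
by rewrite mulrAC ler_pdivlMr// mulrC.
Qed.

(** With x = |U| and C_(m+1) < x <= C_m, the mass of U is at most 1 / N_m up to a
    constant, and 1 / N_m <= C_m^t <= C_(m+1)^s <= x^s. *)
Lemma nprod_le_diam (s t x : R) m : (1 <= m)%N -> 0 <= s ->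
  t < moran_exponent n c m -> C m `^ t <= C m.+1 `^ s -> C m.+1 < x ->
  (N m)%:R^-1 <= x `^ s.
Proof.
move=> m1 s0 tm step Cx; apply: le_trans (exponent_gt _ _ m1 tm) _.
apply: le_trans step _; apply: ge0_ler_powR => //; rewrite ?nnegrE ltW//.
exact: lt_trans Cx.
Qed.

(** For s < t < liminf s_k, every level m beyond some K satisfies t < s_m, and
    sets of positive diameter at most C_K only involve such levels. *)
Lemma liminf_le_hausdorff :
  (limn_einf (fun k => (moran_exponent n c k)%:E) <= hausdorff_dim E)%E.
Proof.
apply: le_ereal_inf_tmp => _ [s [s0 hs] <-]; rewrite leNgt; apply/negP.
move=> /lte_dense_right[t st /limn_einf_gt[K1 hK1]].
have [K2 hK2] := scale_step _ _ s0 st.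
pose K := maxn 1 (maxn K1 K2).
have hK k : (K <= k)%N -> [/\ (1 <= k)%N, (K1 <= k)%N & (K2 <= k)%N].
  by rewrite !geq_max => /and3P[].
have [j [eps [eps0 noc]]] := no_small_cover.
have : (hausdorff_premeasure s (C K) E < eps%:E)%E.
  apply: (@le_lt_trans _ _ 0%E); last by rewrite lte_fin.
  by rewrite -hs; apply: ereal_sup_ubound; exists (C K) => //=.
move=> /ereal_inf_lt[_ [I [U [[EU dU] ->]]] sumU].
apply: (noc I U s EU) (ltW sumU) => i Ii.
have /andP[dge0 dK] := dU i Ii; have fin := diam_fin _ _ dK.
move: dge0 dK; rewrite -(fineK fin) !lee_fin; set x := fine _ => x0 xK.
move: x0; rewrite le_eqVlt => /orP[/eqP x0|x0].
  (* A set of diameter 0 is placed at a level whose mass is within the slack. *)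
  exists (i + j)%N; rewrite -x0 lee_fin ltW//; split=> //.
  rewrite -[leLHS]add0e leeD ?poweR_ge0// lee_fin exprVn.
  rewrite lef_pV2 ?posrE ?exprn_gt0 ?ltr0n ?N0//.
  by rewrite -natrX ler_nat; exact: nprod_ge _.
have [m Km /andP[Cx xC]] := scale_level K x x0 xK.
exists m; rewrite lee_fin xC; split=> //.
have [m1 mK1 mK2] := hK m Km.
rewrite poweR_EFin -EFinD lee_fin ler_wpDr ?exprn_ge0 ?invr_ge0//.
apply: (nprod_le_diam _ t) => //; last exact: hK2.
by have := hK1 m mK1; rewrite lte_fin.
Qed.

Section upper.
Context (theta : R) (htheta : 0 < theta <= 1).

Let minexp k : \bar R :=
  \big[mine/+oo%E]_(k <= m < (lindex c k theta).+1) (moran_exponent n c m)%:E.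

Lemma minexp_lt k (s : R) : (minexp k < s%:E)%E ->
  exists2 m, (k <= m <= lindex c k theta)%N & moran_exponent n c m < s.
Proof.
apply: contraPP => h; apply/negP; rewrite -leNgt.
rewrite /minexp big_nat_cond; apply: le_bigmin => [|m]; first exact: leey.
rewrite andbT ltnS => km; rewrite lee_fin leNgt; apply/negP => ms.
by apply: h; exists m.
Qed.

Lemma minexp_gt k (s : R) : (s%:E < minexp k)%E ->
  forall m, (k <= m <= lindex c k theta)%N -> s < moran_exponent n c m.
Proof.
move=> h m km; rewrite -lte_fin; apply: lt_le_trans h _.
by apply: ge_bigmin_seq => //; rewrite mem_index_iota ltnS.
Qed.

Lemma minexp_ge0 k : (0 <= minexp k)%E.
Proof.
apply: le_bigmin => [|m _]; first exact: leey.
by rewrite lee_fin; exact: moran_exponent_ge0 _.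
Qed.

(** For infinitely many k all exponents s_m with k <= m <= l(k, theta) exceed t.
    At the scale delta = C_k the constraint delta^(1/theta) <= |U_i| <= delta
    confines the level of U_i to exactly this range, as C_l <= delta^(1/theta). *)
Lemma limsup_le_upper : (limn_esup minexp <= upper_intermediate_dim theta E)%E.
Proof.
have /andP[t0 t1] := htheta.
apply: le_ereal_inf_tmp => _ [s [s0 hs] <-]; rewrite leNgt; apply/negP.
move=> /lte_dense_right[t st /limn_esup_gt freq].
have [K1 hK1] := scale_step _ _ s0 st.
have [j [eps [eps0 noc]]] := no_small_cover.
have [Delta Delta0 hD] := hs eps eps0.
have [K2 hK2] := cprod_small _ Delta0.
have [k] := freq (maxn 1 (maxn K1 K2)); rewrite !geq_max => /and3P[k1 kK1 kK2] tk.
have [l [lE kl /andP[Cl _]]] := lindexP _ _ k1 htheta.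
have [|I [U [[EU dU] sumU]]] := hD (C k).
  by rewrite C0 ltW//; exact: hK2.
apply: (noc I U s EU) sumU => i Ii.
have /andP[lx xC] := dU i Ii; have fin := diam_fin _ _ xC.
move: lx xC; rewrite -(fineK fin) !lee_fin; set x := fine _.
rewrite /lower_scale gt_eqF// => /(le_trans Cl) lx xk.
have x0 : 0 < x := lt_le_trans (C0 _) lx.
have [m km /andP[Cx xC]] := scale_level k x x0 xk.
have ml : (m <= l.+1)%N.
  rewrite leqNgt; apply/negP => /cprod_lt.
  by rewrite ltNge (le_trans lx).
exists m; rewrite lee_fin xC; split=> //.
rewrite poweR_EFin -EFinD lee_fin ler_wpDr ?exprn_ge0 ?invr_ge0//.
apply: (nprod_le_diam _ t) => //; first exact: leq_trans km.
  by apply: minexp_gt tk _ _; rewrite lE km.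
by apply: hK1; exact: leq_trans km.
Qed.

(** Every small delta lies between 2 |J| C_k and 2 |J| C_(k-1) for some k, and
    some level m between k and l(k, theta) has s_m < s1 < s. Balls centered in
    the cylinders of level m, enlarged if needed to diameter delta^(1/theta), form
    an admissible cover. By definition of l(k, theta), C_m is not much smaller than
    delta^(1/theta), so that the enlargement costs only a small power. *)
Lemma upper_le_limsup : (upper_intermediate_dim theta E <= limn_esup minexp)%E.
Proof.
have /andP[t0 t1] := htheta; have v1 : 1 <= theta^-1 by rewrite invf_ge1.
have v0 : 0 < theta^-1 by lra.
apply: lee_by_real => s /lte_dense_left[s1 /limn_esup_lt[K1 hK1] s1s].
have s10 : 0 < s1.
  by rewrite -lte_fin; apply: le_lt_trans (minexp_ge0 K1) (hK1 _ (leqnn _)).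
apply: ereal_inf_lbound; exists s; last by []; split=> [|eps eps0]; first lra.
(* Intermediate exponents: comparing consecutive scales happens twice, from
   C_(l+1) to C_l and from C_k to C_(k-1), each time with a loss. *)
pose s2 := s1 + (s - s1) / 3; pose s3 := s1 + (s - s1) * 2 / 3.
have [s12 s23 s3s] : [/\ s1 < s2, s2 < s3 & s3 < s].
  by split; rewrite /s2 /s3; lra.
have s20 : 0 < s2 by lra.
have [K2 hK2] := scale_step _ _ (ltW s10) s12.
have [K3 hK3] := scale_step _ _ (ltW s20) s23.
have b4 : 0 < s - s1 by lra.
have [K4 hK4] := cprod_powR_small ((2 * D) `^ s) _ _ b4 eps0.
have b5 : 0 < (s - s3) / theta by rewrite divr_gt0//; lra.
have [K5 hK5] := cprod_powR_small ((2 * D) `^ (s / theta)) _ _ b5 eps0.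
pose K := maxn K1 (maxn K2 (maxn K3 (maxn K4 K5))).
have D20 : 0 < 2 * D by rewrite mulr_gt0.
exists (Num.min (2 * D * C K) 1); first by rewrite lt_min ltr01 andbT mulr_gt0.
move=> delta /andP[delta0]; rewrite le_min => /andP[deltaK delta1].
have x0 : 0 < delta / (2 * D) by exact: divr_gt0.
have [|k0 Kk0 /andP[Cx xC]] := scale_level K _ x0.
  by rewrite ler_pdivrMr// mulrC.
move: Kk0; rewrite !geq_max => /and5P[k1 k2 k3 k4 k5].
set k := k0.+1 in Cx *.
have [m km ms] := minexp_lt _ _ (hK1 k (leqW k1)).
have [l [lE kl /andP[_ Cl]]] := lindexP k theta isT htheta.
rewrite lE in km; have {km} [km ml] := andP km.
have m1 : (1 <= m)%N by exact: leq_trans km.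
have pos (y : R) : 0 < y -> y \is Num.nneg by move=> ?; rewrite nnegrE ltW.
have Nm : (N m)%:R <= C m `^ (- s1) := exponent_lt _ _ m1 ms.
have Cmk0 : C m <= C k0 by apply: cprod_le; rewrite (leq_trans _ km)// /k.
(* C_m >= C_(l+1), C_(l+1)^s1 >= C_l^s2, C_l > C_k^(1/theta), C_k^s2 >= C_k0^s3. *)
have Nk0 : (N m)%:R <= C k0 `^ (- (s3 / theta)).
  apply: le_trans Nm _; rewrite !powRN lef_pV2 ?posrE ?powR_gt0//.
  have lk0 : (k0 <= l)%N by rewrite -ltnS.
  apply: (@le_trans _ _ (C l.+1 `^ s1)); last first.
    by apply: ge0_ler_powR; rewrite ?pos//; [exact: ltW|exact: (cprod_le _ _ ml)].
  apply: le_trans _ (hK2 l (leq_trans k2 lk0)).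
  apply: (@le_trans _ _ ((C k `^ theta^-1) `^ s2)); last first.
    by apply: ge0_ler_powR; rewrite ?pos ?powR_gt0 ?ltW.
  rewrite powRAC powRrM; apply: ge0_ler_powR; rewrite ?pos ?powR_gt0//; first exact: ltW.
  exact: hK3.
have scale_le : delta `^ theta^-1 <= delta by exact: powR_le_self.
pose r := Num.max (2 * D * C m) (delta `^ theta^-1).
have [|I [U [[EU dU] sumU]]] := moran_cover m r; first by rewrite le_max lexx.
exists I, U; split.
  split=> // i /dU /andP[dl dr]; apply/andP; split.
    apply: le_trans dl; rewrite lee_fin /lower_scale gt_eqF//.
    by rewrite le_max lexx orbT.
  apply: le_trans dr _; rewrite lee_fin ge_max scale_le andbT.
  move: Cx; rewrite ltr_pdivlMr// mulrC => /ltW; apply: le_trans.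
  by rewrite ler_pM2l//; exact: cprod_le _ _ km.
rewrite sumU lee_fin /r; case: (leP (2 * D * C m)) => _.
- have dk0 : delta <= 2 * D * C k0 by rewrite mulrC -ler_pdivrMr.
  apply: le_trans _ (hK5 k0 k5).
  apply: (@le_trans _ _ (C k0 `^ (- (s3 / theta)) *
      ((2 * D) `^ (s / theta) * C k0 `^ (s / theta)))).
    apply: ler_pM; rewrite ?powR_ge0 ?ler0n//.
    rewrite -powRrM (mulrC theta^-1) -(powRM _ (ltW D20) (ltW (C0 k0))).
    by apply: ge0_ler_powR; rewrite ?pos ?mulr_gt0// divr_ge0// ltW//; lra.
  rewrite mulrCA ler_wpM2l ?powR_ge0// -powRD ?(gt_eqF (C0 k0)) ?implybT//.
  by rewrite addrC mulrBl.
- apply: le_trans _ (hK4 k0 k4); rewrite (powRM _ (ltW D20) (ltW (C0 m))).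
  rewrite mulrCA ler_wpM2l ?powR_ge0//.
  apply: (@le_trans _ _ (C m `^ (- s1) * C m `^ s)).
    by rewrite ler_wpM2r ?powR_ge0.
  rewrite -powRD ?(gt_eqF (C0 m)) ?implybT// addrC.
  by apply: ge0_ler_powR; rewrite ?pos//; exact: ltW.
Qed.

End upper.
End subexponential.
End moran.

Theorem corollary1p5 (R : realType) (d : nat) (n : nat -> nat) (c : nat -> R)
    (E : set 'rV[R]_d)
    (hE : homogeneous_moran_set n c E)
    (hc : inf [set c k | k in [set k | (1 <= k)%N]] = 0)
    (hlim : (fun k => ln (c k) / ln (cprod c k)) @ \oo --> (0 : R)) :
  (forall theta : R, 0 < theta <= 1 ->
     upper_intermediate_dim theta E =
     limn_esup (fun k => \big[mine/+oo%E]_(k <= m < (lindex c k theta).+1)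
                           (moran_exponent n c m)%:E)) /\
  (forall theta : R, 0 <= theta <= 1 ->
     lower_intermediate_dim theta E =
       limn_einf (fun k => (moran_exponent n c k)%:E) /\
     limn_einf (fun k => (moran_exponent n c k)%:E) = hausdorff_dim E).
Proof.
have [J [Ju [hM ->]]] := hE; split=> theta htheta.
  apply/le_anti; rewrite (upper_le_limsup _ _ _ _ hM hlim _ htheta).
  exact: (limsup_le_upper _ _ _ _ hM hlim _ htheta).
have low := lower_le_liminf _ _ _ _ hM _ htheta.
have mid := hausdorff_le_lower n Ju theta.
have upp := liminf_le_hausdorff _ _ _ _ hM hlim.
split; apply/le_anti/andP; split=> //.
- exact: le_trans upp mid.
- exact: le_trans mid low.
Qed.
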